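(* Let $X$ be a semi-equivelar map of vertex-type $[p_1^{n_1},\dots,p_\ell^{n_\ell}]$ on a $2$-manifold ($X$ not necessarily finite). If $\sum_{i=1}^{\ell}\frac{n_i(p_i-2)}{p_i}<2$, then $[p_1^{n_1},\dots,p_\ell^{n_\ell}]$ is one of: $[3^3]$, $[3^4]$, $[4^3]$, $[3^5]$, $[5^3]$, $[3^4,5^1]$, $[3^4,4^1]$, $[3^1,5^1,3^1,5^1]$, $[3^1,4^1,3^1,4^1]$, $[3^1,4^1,5^1,4^1]$, $[3^1,4^3]$, $[5^1,6^2]$, $[4^1,6^1,8^1]$, $[4^1,6^1,10^1]$, $[4^1,6^2]$, $[3^1,6^2]$, $[3^1,8^2]$, $[3^1,10^2]$, $[3^1,4^2]$, $[4^2,r^1]$ for some $r\ge 5$, or $[3^3,s^1]$ for some $s\ge 4$.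
   Context: A map is a polyhedral map on a surface: a decomposition into faces, each an $n$-gon ($n\ge3$), such that any two intersecting faces meet in exactly one vertex or exactly one edge. For a vertex $u$, the faces containing $u$ form a cycle (the face-cycle of $u$) of the form $(F_{1,1}\text{-}\cdots\text{-}F_{1,n_1})\text{-}\cdots\text{-}(F_{k,1}\text{-}\cdots\text{-}F_{k,n_k})\text{-}F_{1,1}$ where each $F_{i,l}$ is a $p_i$-gon, $p_r\ne p_{r+1}$ for $1\le r\le k-1$ and $p_k\ne p_1$. A map is semi-equivelar of vertex-type $[p_1^{n_1},\dots,p_k^{n_k}]$ if every vertex has a face-cycle of this form. Cyclic tuples $[p_1^{n_1},\dots,p_k^{n_k}]$ are identified with their cyclic rotations and with their reversal. *)

(* Defs.v *)
From HB Require Import structures.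
From mathcomp Require Import all_boot all_order all_algebra.
From mathcomp Require Import all_classical all_reals topology normedtype.

Set Implicit Arguments.
Unset Strict Implicit.
Unset Printing Implicit Defensive.

Import Order.TTheory GRing.Theory Num.Theory.
Import numFieldNormedType.Exports.

Local Open Scope classical_set_scope.
Local Open Scope ring_scope.

(* f restricts to a homeomorphism from the subspace A onto the subspace B *)
Definition homeo_on (S T : topologicalType) (A : set S) (B : set T)
    (f : S -> T) : Prop :=
  [/\ set_bij A B f, {within A, continuous f} &
      exists g : T -> S,
        {within B, continuous g} /\ (forall x, A x -> g (f x) = x)].

(* Without boundary; connectedness is not required. *)
Definition two_manifold (R : realType) (M : topologicalType) : Prop :=
  [/\ [set: M] !=set0, hausdorff_space M, @second_countable M &
      forall x : M, exists (U : set M) (W : set (R * R)%type)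
        (f : M -> (R * R)%type),
        [/\ open U, U x, open W & homeo_on U W f]].

Definition closed_disc (R : realType) : set (R * R)%type :=
  [set z | z.1 ^+ 2 + z.2 ^+ 2 <= 1].

Definition unit_circle (R : realType) : set (R * R)%type :=
  [set z | z.1 ^+ 2 + z.2 ^+ 2 = 1].

Record cell_data (M : topologicalType) := CellData {
  vertices : set M;
  edges : set (set M);
  faces : set (set M) }.

Section PolyhedralMap.
Variables (R : realType) (M : topologicalType) (K : cell_data M).

Definition skeleton : set M := vertices K `|` \bigcup_(e in edges K) e.

Definition is_edge (e : set M) : Prop :=
  exists g : R -> M,
    homeo_on (`[0, 1] : set R) e g /\ e `&` vertices K = [set g 0; g 1].

(* F is a closed disc whose boundary circle is the cycle
   v_0 -e_0- v_1 -e_1- ... -e_(n-1)- v_0 of the 1-skeleton, the interior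
   of F being disjoint from the 1-skeleton. *)
Definition ngon (n : nat) (F : set M) : Prop :=
  (3 <= n)%N /\
  exists (h : (R * R)%type -> M) (v : 'I_n -> M) (e : 'I_n -> set M),
  [/\ homeo_on (@closed_disc R) F h,
      injective v,
      forall i, vertices K (v i),
      forall i, edges K (e i) /\ e i `&` vertices K = [set v i; v (ordS i)] &
      h @` @unit_circle R = \bigcup_i e i /\
      F `&` skeleton = h @` @unit_circle R].

Definition polyhedral_map : Prop :=
  [/\ (forall e, edges K e -> is_edge e) /\
      (forall e e', edges K e -> edges K e' -> e <> e' ->
         e `&` e' `<=` vertices K),
      forall F, faces K F -> exists n, ngon n F,
      \bigcup_(F in faces K) F = [set: M],
      forall x : M, exists2 U : set M, nbhs x U &
        finite_set [set F | faces K F /\ F `&` U !=set0] &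
      forall F G, faces K F -> faces K G -> F <> G -> F `&` G !=set0 ->
        (exists2 v, vertices K v & F `&` G = [set v]) \/
        (exists2 e, edges K e & F `&` G = e)].

(* F_0 - F_1 - ... - F_(d-1) - F_0 lists the faces containing u in the cyclic
   order around u, e_i being the edge at u between F_i and F_(i+1). *)
Definition face_cycle (u : M) (d : nat) (F : 'I_d -> set M) : Prop :=
  [/\ injective F,
      range F = [set G | faces K G /\ G u] &
      exists e : 'I_d -> set M,
        [/\ injective e,
            range e = [set c | edges K c /\ c u] &
            forall i, e i `<=` F i /\ e i `<=` F (ordS i)]].

End PolyhedralMap.

(* [p_1^n_1, ..., p_k^n_k] is encoded as [:: (p_1, n_1); ...; (p_k, n_k)]. *)
Definition vertex_type := seq (nat * nat).

(* For k = 1 the condition p_k <> p_1 is void. *)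
Definition wf_vertex_type (t : vertex_type) : bool :=
  [&& (0 < size t)%N, all (fun b => 0 < b.2)%N t &
      (size t == 1%N) || path.cycle (fun b c => b.1 != c.1) t].

Definition expand (t : vertex_type) : seq nat :=
  flatten [seq nseq b.2 b.1 | b <- t].

Definition semi_equivelar (R : realType) (M : topologicalType)
    (K : cell_data M) (t : vertex_type) : Prop :=
  [/\ polyhedral_map R K, wf_vertex_type t &
      forall u, vertices K u ->
        exists F : 'I_(size (expand t)) -> set M,
          face_cycle K u F /\
          forall i : 'I_(size (expand t)),
            ngon R K (nth 0%N (expand t) i) (F i)].

Definition same_type (t t' : vertex_type) : Prop :=
  exists k : nat, t' = rot k t \/ t' = rot k (rev t).

Definition sporadic_types : seq vertex_type :=
  [:: [:: (3, 3)];
      [:: (3, 4)];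
      [:: (4, 3)];
      [:: (3, 5)];
      [:: (5, 3)];
      [:: (3, 4); (5, 1)];
      [:: (3, 4); (4, 1)];
      [:: (3, 1); (5, 1); (3, 1); (5, 1)];
      [:: (3, 1); (4, 1); (3, 1); (4, 1)];
      [:: (3, 1); (4, 1); (5, 1); (4, 1)];
      [:: (3, 1); (4, 3)];
      [:: (5, 1); (6, 2)];
      [:: (4, 1); (6, 1); (8, 1)];
      [:: (4, 1); (6, 1); (10, 1)];
      [:: (4, 1); (6, 2)];
      [:: (3, 1); (6, 2)];
      [:: (3, 1); (8, 2)];
      [:: (3, 1); (10, 2)];
      [:: (3, 1); (4, 2)]]%N.

(* Main.v *)
(* Write the vertex-type as the cyclic word of the sizes of the faces around a
   vertex. Two faces share at most one edge, so this word has length at least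
   3, and the angle hypothesis, which says that the sum of the inverses of its
   letters exceeds (d - 2) / 2 for a word of length d, bounds the length by 5.
   Topology enters once more through a parity argument: if p is odd and every
   occurrence of p in the word has exactly one neighbour in some set S, then
   around a p-gon the faces across consecutive sides alternate between sizes in
   S and sizes outside S, which is impossible. A word with a letter at least 12
   that survives the inequality and the parity argument is 4,4,r or 3,3,3,s up
   to rotation; the finitely many other words are enumerated. *)

From mathcomp Require Import all_boot all_order all_algebra.
From mathcomp Require Import all_classical all_reals topology normedtype.
From mathcomp Require Import zify ring lra.
Require Import Defs.

Set Implicit Arguments.
Unset Strict Implicit.
Unset Printing Implicit Defensive.

Import Order.TTheory GRing.Theory Num.Theory.

Local Open Scope ring_scope.

(** * Cyclic successor and alternation around a cycle *)

Lemma ordS_neq (d : nat) (i : 'I_d) : (1 < d)%N -> ordS i != i.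
Proof.
move=> d1; apply/eqP => /(congr1 val) /=.
have := ltn_ord i; rewrite leq_eqVlt => /orP[/eqP dE|ltd].
  by rewrite dE modnn; lia.
by rewrite modn_small //; lia.
Qed.

Lemma ordS_ordS_neq (d : nat) (i : 'I_d) : (2 < d)%N -> ordS (ordS i) != i.
Proof.
move=> d2; apply/eqP => /(congr1 val) /=.
have := ltn_ord i; rewrite leq_eqVlt => /orP[/eqP dE|ltd].
  by rewrite dE modnn modn_small; lia.
rewrite (modn_small ltd).
move: ltd; rewrite leq_eqVlt => /orP[/eqP dE|ltd].
  by rewrite dE modnn; lia.
by rewrite modn_small //; lia.
Qed.

(** Going once around the cycle flips the value [n] times and returns to the start. *)
Lemma ordS_alternating_even (n : nat) (b : 'I_n -> bool) :
  (forall i, b (ordS i) = ~~ b i) -> ~~ odd n.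
Proof.
case: n b => // n b bS; apply/negP => /= n_even.
have bE k : (k < n.+1)%N -> b (inord k) = odd k (+) b ord0.
  elim: k => [|k IH] kn; first by congr b; apply/val_inj; rewrite /= inordK.
  have -> : inord k.+1 = ordS (inord k) :> 'I_n.+1.
    by apply/val_inj; rewrite /= !inordK ?modn_small //; lia.
  by rewrite bS IH ?addNb //; lia.
have := bS ord_max; have -> : ordS ord_max = ord0 :> 'I_n.+1.
  by apply/val_inj; rewrite /= modnn.
have -> : ord_max = inord n :> 'I_n.+1 by apply/val_inj; rewrite /= inordK.
by rewrite bE // (negbTE n_even); case: (b ord0).
Qed.

(** * From topological discs to polygons and face-cycles *)

Section Geometry.
Local Open Scope classical_set_scope.

(** The midpoint of the arc would be a vertex, although the only vertices on an edge are its two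
    ends. *)
Lemma edge_not_sub_vertices (R : realType) (M : topologicalType)
    (K : cell_data M) (c : set M) :
  polyhedral_map R K -> edges K c -> ~ (c `<=` vertices K).
Proof.
case=> [[edgeP _] _ _ _ _] /edgeP[g [[[gfun ginj _] _ _] gE]] cV.
have in01 (x : R) : 0 <= x <= 1 -> x \in (`[0, 1]%classic : set R).
  by move=> x01; rewrite inE /= in_itv.
have h01 : 2%:R^-1 \in (`[0, 1]%classic : set R) by apply: in01; lra.
have ch : c (g 2%:R^-1) by apply: gfun; exact: set_mem.
have : (c `&` vertices K) (g 2%:R^-1) by split=> //; exact: cV.
rewrite gE => -[] /(ginj _ _ h01) => H.
  by suff : 2%:R^-1 = 0 :> R; [lra | apply: H; apply: in01; lra].
by suff : 2%:R^-1 = 1 :> R; [lra | apply: H; apply: in01; lra].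
Qed.

(** Distinct edges meet only in vertices, so an inclusion between them would make every point of [c]
    a vertex. *)
Lemma edge_sub_eq (R : realType) (M : topologicalType) (K : cell_data M)
    (c c' : set M) :
  polyhedral_map R K -> edges K c -> edges K c' -> c `<=` c' -> c = c'.
Proof.
move=> pK Kc Kc' cc'; apply: contrapT => ne.
apply: (edge_not_sub_vertices pK Kc) => x cx.
by case: pK => [[_ /(_ _ _ Kc Kc' ne)] + _ _ _ _]; apply; split=> //; exact: cc'.
Qed.

(* What remains of [ngon] once the topology is forgotten. *)
Definition polygon (M : topologicalType) (K : cell_data M) (n : nat)
    (F : set M) (v : 'I_n -> M) (e : 'I_n -> set M) : Prop :=
  [/\ injective e,
      forall i, vertices K (v i),
      forall i, [/\ edges K (e i), e i `<=` F, e i (v i) & e i (v (ordS i))],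
      forall u, vertices K u -> F u -> exists i, u = v i &
      forall c i, edges K c -> c `<=` F -> c (v (ordS i)) ->
        c = e i \/ c = e (ordS i)]
  /\ forall c, edges K c -> c `<=` F -> exists i, c = e i.

Lemma ngon_polygon (R : realType) (M : topologicalType) (K : cell_data M)
    (n : nat) (F : set M) :
  polyhedral_map R K -> ngon R K n F -> exists v e, @polygon M K n F v e.
Proof.
move=> pK [n3 [h [v [e [hF vinj vK eP [hE FE]]]]]].
exists v, e.
have eF i : e i `<=` F.
  by move=> x ex; have [] : (F `&` skeleton K) x by rewrite FE hE; exists i.
have ev i : e i (v i) /\ e i (v (ordS i)).
  have [_ eV] := eP i.
  have [] : (e i `&` vertices K) (v i) by rewrite eV; left.
  have [] : (e i `&` vertices K) (v (ordS i)) by rewrite eV; right.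
  by [].
have evP k i : e k (v i) -> i = k \/ i = ordS k.
  move=> ekv; have : (e k `&` vertices K) (v i) by split.
  by rewrite (eP k).2 => -[] /vinj ->; [left | right].
(* Two coinciding sides with different indices would each be the successor of the other, impossible
   when [n >= 3]. *)
have einj : injective e.
  move=> i j eij.
  have [//|iS] : i = j \/ i = ordS j by apply: evP; rewrite -eij; exact: (ev i).1.
  have [//|jS] : j = i \/ j = ordS i by apply: evP; rewrite eij; exact: (ev j).1.
  by move: (ordS_ordS_neq i n3); rewrite -jS -iS eqxx.
(* An edge inside [F] lies on the boundary circle, hence in the union of the sides. Were it none of
   them, each of its points would be common to two distinct edges, hence a vertex. *)
have eall c : edges K c -> c `<=` F -> exists i, c = e i.
  move=> Kc cF; apply: contrapT => /forallNP ne.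
  apply: (edge_not_sub_vertices pK Kc) => x cx.
  have [k _ ek] : (\bigcup_i e i) x.
    rewrite -hE -FE; split; first exact: cF.
    by right; exists c.
  by case: pK => [[_ /(_ _ _ Kc (eP k).1 (ne k))] + _ _ _ _]; apply; split.
split=> //; split=> //.
- by move=> i; have [] := ev i; have [] := eP i; split.
- move=> u Vu Fu.
  have [k _ ek] : (\bigcup_i e i) u by rewrite -hE -FE; split=> //; left.
  have : (e k `&` vertices K) u by split.
  by rewrite (eP k).2 => -[] ->; [exists k | exists (ordS k)].
- move=> c i Kc cF cv; have [k cE] := eall _ Kc cF.
  move: cv; rewrite cE => /evP[<-|/ordS_inj ->]; [by right | by left].
Qed.

Lemma polygon_size_leq (M : topologicalType) (K : cell_data M) (n m : nat)
    (F : set M) v e v' e' :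
  @polygon M K n F v e -> @polygon M K m F v' e' -> (n <= m)%N.
Proof.
move=> [[einj _ eP _ _] _] [_ eall'].
have /choice[f fP] : forall i, exists j, e i = e' j.
  by move=> i; have [Ke eF _ _] := eP i; exact: eall'.
have finj : injective f by move=> i j fij; apply: einj; rewrite !fP fij.
by have := leq_card f finj; rewrite !card_ord.
Qed.

(** Makes the size of a face well defined: whichever disc parametrization is chosen, the sides are
    exactly the edges contained in [F]. *)
Lemma ngon_inj (R : realType) (M : topologicalType) (K : cell_data M)
    (n m : nat) (F : set M) :
  polyhedral_map R K -> ngon R K n F -> ngon R K m F -> n = m.
Proof.
move=> pK /(ngon_polygon pK)[v [e P]].
move=> /(ngon_polygon pK)[v' [e' P']].
by apply/eqP; rewrite eqn_leq (polygon_size_leq P P')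
  (polygon_size_leq P' P).
Qed.

Definition edge_cycle (M : topologicalType) (K : cell_data M) (u : M)
    (d : nat) (F e : 'I_d -> set M) : Prop :=
  [/\ injective e, range e = [set c | edges K c /\ c u] &
      forall i, e i `<=` F i /\ e i `<=` F (ordS i)].

Lemma edge_cycleP (M : topologicalType) (K : cell_data M) (u : M)
    (d : nat) (F e : 'I_d -> set M) :
  edge_cycle K u F e ->
  forall i, [/\ edges K (e i), e i u, e i `<=` F i &
                e (ord_pred i) `<=` F i].
Proof.
move=> [_ eR eF] i.
have [Ke eu] : [set c | edges K c /\ c u] (e i) by rewrite -eR; exists i.
split=> //; first exact: (eF i).1.
by have := (eF (ord_pred i)).2; rewrite ord_predK.
Qed.

(* At [u], the two edges of the cycle incident with the polygon [F i] are the
   two sides of [F i] through [u]. *)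
Lemma edge_cycle_sides (M : topologicalType) (K : cell_data M) (u : M)
    (d : nat) (F e : 'I_d -> set M) (i : 'I_d) (n : nat)
    (v : 'I_n -> M) (s : 'I_n -> set M) (j : 'I_n) :
  (1 < d)%N -> edge_cycle K u F e -> polygon K (F i) v s -> u = v (ordS j) ->
  (s j = e i /\ s (ordS j) = e (ord_pred i)) \/
  (s j = e (ord_pred i) /\ s (ordS j) = e i).
Proof.
move=> d1 eC [[_ _ _ _ sP] _] uE.
have [Ki iu iF piF] := edge_cycleP eC i.
have [Kp pu _ _] := edge_cycleP eC (ord_pred i).
have [einj _ _] := eC.
have epi : e (ord_pred i) <> e i.
  move=> /einj pii; have := ordS_neq i d1.
  by rewrite -[X in _ != X](ord_predK i) pii eqxx.
rewrite uE in iu pu.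
case: (sP _ _ Ki iF iu) => iE; case: (sP _ _ Kp piF pu) => pE.
- by case: epi; rewrite iE pE.
- by left.
- by right.
- by case: epi; rewrite iE pE.
Qed.

Lemma polygon_vertex_succ (M : topologicalType) (K : cell_data M) (n : nat)
    (F : set M) (v : 'I_n -> M) (s : 'I_n -> set M) (u : M) :
  polygon K F v s -> vertices K u -> F u -> exists j, u = v (ordS j).
Proof.
move=> [[_ _ _ vP _] _] Ku Fu; have [k uk] := vP _ Ku Fu.
by exists (ord_pred k); rewrite ord_predK.
Qed.

Lemma face_cycle_at (M : topologicalType) (K : cell_data M) (u : M)
    (d : nat) (F : 'I_d -> set M) (i : 'I_d) :
  face_cycle K u F -> faces K (F i) /\ F i u.
Proof.
by move=> [_ FR _]; have : range F (F i); [exists i | rewrite FR].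
Qed.

(** Only two sides of [F k] pass through [u], namely [e k] and [e (ord_pred k)], and [e i] is one of
    them. *)
Lemma face_cycle_edge (R : realType) (M : topologicalType) (K : cell_data M)
    (u : M) (d : nat) (F e : 'I_d -> set M) (i k : 'I_d) :
  polyhedral_map R K -> (1 < d)%N -> vertices K u -> face_cycle K u F ->
  edge_cycle K u F e -> e i `<=` F k -> k = i \/ k = ordS i.
Proof.
move=> pK d1 Ku FC eC eF.
have [Kk Fu] := face_cycle_at k FC.
have [n /(ngon_polygon pK)[v [s P]]] : exists n, ngon R K n (F k).
  by case: pK => _ + _ _ _; apply.
have [j uE] := polygon_vertex_succ P Ku Fu.
have [Ki iu _ _] := edge_cycleP eC i.
have [einj _ _] := eC.
have ik : e i = e k \/ e i = e (ord_pred k).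
  have [[_ _ _ _ sP] _] := P.
  rewrite uE in iu.
  by case: (sP _ _ Ki eF iu) => ->;
    case: (edge_cycle_sides d1 eC P uE) => -[sj sj'];
    rewrite ?sj ?sj'; [left|right|right|left].
by case: ik => /einj ->; [left | right; rewrite ord_predK].
Qed.

(** A face at [u] has two distinct sides there, so [d >= 2]. If [d = 2], the two faces share two
    edges, although their intersection is one vertex or one edge. *)
Lemma face_cycle_size (R : realType) (M : topologicalType) (K : cell_data M)
    (u : M) (d : nat) (F : 'I_d -> set M) :
  polyhedral_map R K -> vertices K u -> face_cycle K u F -> (2 < d)%N.
Proof.
move=> pK Ku FC.
have [Finj FR [e eC]] := FC; have [einj eR eF] := eC.
have [i] : exists i : 'I_d, True.
  have [G KG Gu] : (\bigcup_(G in faces K) G) u by case: pK => _ _ -> _ _.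
  by have [i] : range F G; [rewrite FR | exists i].
have [Ki Fu] := face_cycle_at i FC.
have [n ng] : exists n, ngon R K n (F i) by case: pK => _ + _ _ _; apply.
have n3 : (2 < n)%N by case: ng.
have [v [s P]] := ngon_polygon pK ng.
have [j uE] := polygon_vertex_succ P Ku Fu.
have [[sinj _ sP _ _] _] := P.
have [a _ sa] : range e (s j).
  by rewrite eR uE; have [] := sP j.
have [b _ sb] : range e (s (ordS j)).
  by rewrite eR uE; have [] := sP (ordS j).
have ab : a != b.
  apply/eqP => abE; have : s j = s (ordS j) by rewrite -sa -sb abE.
  by move/sinj => jE; have := ordS_neq j (ltnW n3); rewrite -jE eqxx.
move=> _; rewrite ltnNge; apply/negP => d2.
have dE : d = 2.
  have := ltn_ord a; have := ltn_ord b.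
  by move: ab; rewrite -val_eqE /=; lia.
(* With [d = 2], each edge at [u] lies between [F a] and [F (ordS a)]. *)
have ends k : e k `<=` F a `&` F (ordS a).
  have SS : ordS (ordS a) = a.
    apply/val_inj => /=; have := ltn_ord a.
    by move: (nat_of_ord a) => m; rewrite dE; lia.
  have [->|->] : k = a \/ k = ordS a.
    have [/eqP ka|ka] := boolP (k == a); [by left | right].
    apply/val_inj => /=; move: ka; rewrite -val_eqE /=.
    have := ltn_ord k; have := ltn_ord a.
    by move: (nat_of_ord a) (nat_of_ord k) => m l; rewrite dE; lia.
  - by move=> x ex; split; [apply: (eF a).1 | apply: (eF a).2].
  - move=> x ex; split; last exact: (eF (ordS a)).1.
    by rewrite -[in F _]SS; apply: (eF (ordS a)).2.
have aS : F a <> F (ordS a).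
  by move=> /Finj aS; have := @ordS_neq d a; rewrite -aS eqxx => /(_ (eq_leq (esym dE))).
have [Ka Fau] := face_cycle_at a FC; have [Ka' Fau'] := face_cycle_at (ordS a) FC.
have Fne : F a `&` F (ordS a) !=set0 by exists u.
have Ke k : edges K (e k) by have [] := edge_cycleP eC k.
have : (exists2 x, vertices K x & F a `&` F (ordS a) = [set x]) \/
       (exists2 c, edges K c & F a `&` F (ordS a) = c).
  by case: pK => _ _ _ _; apply.
case=> [[x Kx FE]|[c Kc FE]].
  by apply: (edge_not_sub_vertices pK (Ke a)) => y /ends; rewrite FE => ->.
have ec k : e k = c by apply: (edge_sub_eq pK) => //; rewrite -FE; exact: ends.
by have := ab; rewrite (einj a b) ?eqxx // !ec.
Qed.

Lemma polyhedral_map_vertex (R : realType) (M : topologicalType)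
    (K : cell_data M) :
  [set: M] !=set0 -> polyhedral_map R K -> vertices K !=set0.
Proof.
move=> [x _] pK; have [_ KN KC _ _] := pK.
have [F KF Fx] : (\bigcup_(F in faces K) F) x by rewrite KC.
have [[//|n] ng] := KN _ KF; first by case: ng.
have [v [s [[_ vK _ _ _] _]]] := ngon_polygon pK ng.
by exists (v ord0).
Qed.

(* Around an odd [p]-gon the faces across consecutive sides would alternate
   between sizes in [S] and sizes outside [S]. *)
Lemma odd_face_parity (R : realType) (M : topologicalType) (K : cell_data M)
    (t : vertex_type) (p : nat) (S : pred nat) :
  [set: M] !=set0 -> semi_equivelar R K t -> odd p -> p \in expand t ->
  ~ (forall i : 'I_(size (expand t)), nth 0%N (expand t) i = p ->
       S (nth 0%N (expand t) (ord_pred i)) =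
       ~~ S (nth 0%N (expand t) (ordS i))).
Proof.
set w := expand t => M0 [pK _ tP] podd pw Sxor.
have [u Ku] := polyhedral_map_vertex M0 pK.
have [F0 [FC0 Fn0]] := tP _ Ku.
have d3 := face_cycle_size pK Ku FC0; have d2 := ltnW d3.
have pw' : (index p w < size w)%N by rewrite index_mem.
pose i0 := Ordinal pw'; pose F := F0 i0.
have [KF _] : faces K F /\ F u := face_cycle_at i0 FC0.
have ngF : ngon R K p F by have := Fn0 i0; rewrite /= nth_index.
have [v [s P]] := ngon_polygon pK ngF; have [[_ vK sP _ _] _] := P.
(* [Q c] says that some face across [c] from [F] has size in [S]. No vertex is mentioned, so the two
   ends of a side give it the same value. *)
pose Q (c : set M) := `[< exists H n,
  [/\ faces K H, H <> F, c `<=` H, ngon R K n H & S n] >].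
apply/negP: podd; apply: (@ordS_alternating_even p (fun j => Q (s j))) => j.
pose x := v (ordS j).
have [G [GC Gn]] := tP x (vK _).
have [Ginj GR [e eC]] := GC; have [einj eR eG] := eC.
have [i _ GiF] : range G F.
  by rewrite GR; split=> //; have [_ sF _ sx] := sP j; exact: sF.
have P' : polygon K (G i) v s by rewrite GiF.
have iw : nth 0%N w i = p by apply: (ngon_inj pK (Gn i)); rewrite GiF.
have Si : ordS i <> i by apply/eqP/ordS_neq.
have pi : ord_pred i <> i.
  by move=> pii; apply: Si; rewrite -[in LHS]pii ord_predK.
(* When [G l] is the only face other than [F] across [e k] at this corner, [Q] reads off the letter
   at [l]. *)
have QE k l : e k `<=` G l -> l <> i ->
    (forall l', e k `<=` G l' -> l' <> i -> l' = l) -> Q (e k) = S (nth 0%N w l).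
  move=> ekl li luniq; apply/asboolP/idP.
    move=> [H [n [KH HF eH Hn Sn]]].
    have [l' _ Hl'] : range G H.
      by rewrite GR; split=> //; apply: eH; have [] := edge_cycleP eC k.
    have l'E : l' = l.
      apply: luniq; first by rewrite Hl'.
      by move=> l'i; apply: HF; rewrite -Hl' l'i.
    by rewrite (ngon_inj pK (Gn l) (m := n)) // -l'E Hl'.
  move=> Sl; exists (G l), (nth 0%N w l); split=> //.
  - exact: (face_cycle_at l GC).1.
  - by rewrite -GiF => /Ginj.
have Qi : Q (e i) = S (nth 0%N w (ordS i)).
  apply: QE => //; first exact: (eG i).2.
  by move=> l' /(face_cycle_edge pK d2 (vK _) GC eC)[].
have Qp : Q (e (ord_pred i)) = S (nth 0%N w (ord_pred i)).
  apply: QE => //; first exact: (eG _).1.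
  by move=> l' /(face_cycle_edge pK d2 (vK _) GC eC)[//|->]; rewrite ord_predK.
(* The cycle at [x] may turn in either direction relative to the boundary of [F]; the alternation is
   symmetric. *)
case: (edge_cycle_sides d2 eC P' erefl) => -[-> ->]; rewrite Qi Qp (Sxor i iw) //.
by rewrite negbK.
Qed.
End Geometry.

(** * The parity obstruction on words *)

(** A computable form of the hypothesis of [odd_face_parity], with [S] restricted to singletons
    [{a}]. Letters [a] outside [w] could never pass, since [p] does occur. Adding [size w] before
    the predecessor handles the wrap-around at [0]. *)
Definition parity_obstructed (w : seq nat) : bool :=
  has (fun p => odd p && has (fun a =>
    all (fun i => (nth 0%N w i == p) ==>
      ((nth 0%N w ((i + size w).-1 %% size w) == a) (+)
       (nth 0%N w (i.+1 %% size w) == a))) (iota 0 (size w))) w) w.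

Lemma semi_equivelar_parity (R : realType) (M : topologicalType)
    (K : cell_data M) (t : vertex_type) :
  [set: M]%classic !=set0%classic -> semi_equivelar R K t ->
  ~~ parity_obstructed (expand t).
Proof.
move=> M0 tP; apply/hasPn => p pw; apply/negP => /andP[podd /hasP[a _ /allP aP]].
apply: (odd_face_parity M0 tP podd pw (S := pred1 a)) => i iw.
have /aP : nat_of_ord i \in iota 0 (size (expand t)).
  by rewrite mem_iota add0n ltn_ord.
by rewrite iw eqxx /=; do 2!case: (_ == a).
Qed.

Lemma semi_equivelar_word (R : realType) (M : topologicalType)
    (K : cell_data M) (t : vertex_type) :
  [set: M]%classic !=set0%classic -> semi_equivelar R K t ->
  (2 < size (expand t))%N /\ all (leq 3) (expand t).
Proof.
move=> M0 [pK _ tP]; have [u Ku] := polyhedral_map_vertex M0 pK.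
have [F [FC Fn]] := tP _ Ku; split; first exact: face_cycle_size pK Ku FC.
by apply/(all_nthP 0%N) => i iw; have [] := Fn (Ordinal iw).
Qed.

(** * Vertex-types as words, and the angle sum *)

(** Recovers a well-formed type from its word. Runs are read linearly: one that wraps around the
    ends is left split, and the result is then not well formed. *)
Fixpoint run_lengths (w : seq nat) : vertex_type :=
  if w is x :: w' then
    if run_lengths w' is (y, n) :: t then
      if x == y then (x, n.+1) :: t else (x, 1%N) :: (y, n) :: t
    else [:: (x, 1%N)]
  else [::].

(** Positive multiplicities keep every run nonempty, and distinct neighbours keep consecutive runs
    from merging. *)
Lemma expandK (t : vertex_type) :
  all (fun b => 0 < b.2)%N t -> sorted (fun b c => b.1 != c.1) t ->
  run_lengths (expand t) = t.
Proof.
elim: t => // -[p n] t IH /= /andP[n0 t0] pt.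
rewrite /expand /= -/(expand t).
have {}IH : run_lengths (expand t) = t.
  by apply: IH => //; exact: path_sorted pt.
have {}pt : if t is b :: _ then p != b.1 else true.
  by case: t pt {t0 IH} => //= b t /andP[].
elim: n n0 => // -[|n] IHn _ /=.
  by rewrite IH; case: t pt {t0 IH IHn} => //= -[q m] t /negbTE /= ->.
by move: IHn => /= -> //; rewrite eqxx.
Qed.

Lemma wf_expandK (t : vertex_type) :
  wf_vertex_type t -> run_lengths (expand t) = t.
Proof.
move=> /and3P[t0 tpos tP]; apply: expandK => //.
case: t tP {t0 tpos} => // b t /= /orP[|]; first by case: t.
by rewrite rcons_path => /andP[].
Qed.

(** A block contributes [n] copies of [(p - 2) / p = 1 - 2 / p], so the angle hypothesis depends
    only on the word. *)
Lemma angle_sum_expand (t : vertex_type) :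
  all (leq 3) (expand t) ->
  \sum_(b <- t) (b.2%:R * (b.1%:R - 2%:R) / b.1%:R : rat) =
  (size (expand t))%:R - 2 * \sum_(x <- expand t) x%:R^-1.
Proof.
move=> w3; transitivity (\sum_(x <- expand t) (1 - 2 * x%:R^-1 : rat)).
  elim: t w3 => [|[p n] t IH]; first by rewrite !big_nil.
  rewrite /expand /= -/(expand t) all_cat => /andP[p3 /IH {}IH].
  rewrite big_cons big_cat /= IH; congr (_ + _).
  (* An empty block leaves [p] unconstrained, possibly [0], but its factor [n] is zero. *)
  case: n p3 => [|n] p3; first by rewrite big_nil !mul0r.
  have p0 : p%:R != 0 :> rat by rewrite pnatr_eq0; move: p3 => /=; lia.
  rewrite big_nseq iter_addr_0 -mulr_natl.
  by field.
rewrite sumrB -mulr_sumr; congr (_ - _).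
by rewrite big_const_seq count_predT iter_addr addr0.
Qed.

(* The numerator and denominator of the sum of the inverses. *)
Definition inv_sum (w : seq nat) : nat * nat :=
  foldr (fun x q => (q.2 + x * q.1, x * q.2)%N) (0, 1)%N w.

Lemma inv_sumE (w : seq nat) : all (leq 3) w ->
  (0 < (inv_sum w).2)%N /\
  \sum_(x <- w) (x%:R^-1 : rat) = (inv_sum w).1%:R / (inv_sum w).2%:R.
Proof.
elim: w => [_|x w IH /= /andP[x3 /IH[d0 E]]]; first by rewrite big_nil mul0r.
split; first by rewrite muln_gt0 d0 andbT; lia.
rewrite big_cons E natrD !natrM; field.
by rewrite !pnatr_eq0 -!lt0n d0; lia.
Qed.

(** The angle inequality multiplied by the common denominator and rearranged without subtraction, so
    that it computes in [nat]. *)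
Definition small_angle (w : seq nat) : bool :=
  let q := inv_sum w in (size w * q.2 < 2 * q.1 + 2 * q.2)%N.

Lemma small_angleP (w : seq nat) : all (leq 3) w ->
  (size w)%:R - 2 * \sum_(x <- w) x%:R^-1 < 2 :> rat -> small_angle w.
Proof.
move=> /inv_sumE[d0 ->]; rewrite /small_angle /= -(ltr_nat rat) natrD !natrM.
move: (inv_sum w) d0 => [n d] /= d0.
have {}d0 : 0 < d%:R :> rat by rewrite ltr0n.
rewrite -(ltr_pM2r d0) mulrBl -mulrA divfK ?gt_eqF // => H; lra.
Qed.

(** * Finite enumeration of words with small letters *)

(** Rotations by [0] to [4] are enough for types with at most five blocks, as words have length at
    most 5. *)
Definition listed_upto (N : nat) (t : vertex_type) : bool :=
  has (fun t' => has (fun k => (t' == rot k t) || (t' == rot k (rev t)))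
                   (iota 0 5))
    (sporadic_types ++ [seq [:: (4, 2); (r, 1)]%N | r <- iota 5 N]
                    ++ [seq [:: (3, 3); (s, 1)]%N | s <- iota 4 N]).

Definition listed (t : vertex_type) : Prop :=
  (exists2 t' : vertex_type, t' \in sporadic_types & same_type t t') \/
  (exists2 r : nat, (5 <= r)%N & same_type t [:: (4, 2); (r, 1)]%N) \/
  (exists2 s : nat, (4 <= s)%N & same_type t [:: (3, 3); (s, 1)]%N).

Lemma listed_uptoP (N : nat) (t : vertex_type) : listed_upto N t -> listed t.
Proof.
move=> /hasP[t' t'L /hasP[k _ tk]].
have st : same_type t t'.
  by exists k; case/orP: tk => /eqP ->; [left | right].
move: t'L; rewrite !mem_cat => /or3P[t's|/mapP[r]|/mapP[s]].
- by left; exists t'.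
- by rewrite mem_iota => /andP[r5 _] E; right; left; exists r; rewrite -?E.
- by rewrite mem_iota => /andP[s4 _] E; right; right; exists s; rewrite -?E.
Qed.

Fixpoint words (A : seq nat) (d : nat) : seq (seq nat) :=
  if d is d'.+1 then [seq x :: w | x <- A, w <- words A d'] else [:: [::]].

Lemma mem_words (A w : seq nat) : all (mem A) w -> w \in words A (size w).
Proof.
elim: w => [|x w IH]; first by rewrite inE.
by move=> /= /andP[xA /IH wA]; apply/allpairsP; exists (x, w).
Qed.

(** With [N = 8] the families reach [r = 12] and [s = 11], which covers the letters 3 to 11
    enumerated below. Nested conditionals let evaluation stop at the first test that settles the
    word. *)
Definition classified (w : seq nat) : bool :=
  if parity_obstructed w then true else
  if wf_vertex_type (run_lengths w) then
    if small_angle w then listed_upto 8 (run_lengths w) else true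
  else true.

Lemma classified3 : all classified (words (iota 3 9) 3).
Proof. by vm_compute. Qed.

Lemma classified4 : all classified (words (iota 3 9) 4).
Proof. by vm_compute. Qed.

Lemma classified5 : all classified (words (iota 3 3) 5).
Proof. by vm_compute. Qed.

(** * Parity and inequalities for words with a large letter *)

(** In a word of length three the neighbours of a letter are the other two. If [a] is odd and
    [b <> c], the pair [p = a], [S = {b}] is an obstruction, even when [a] is repeated. *)
Lemma parity3 (a b c : nat) :
  ~~ parity_obstructed [:: a; b; c] ->
  [/\ odd a -> b = c, odd b -> a = c & odd c -> a = b].
Proof.
rewrite /parity_obstructed /= !eqxx !(eq_sym b a) !(eq_sym c a) !(eq_sym c b).
(* These facts discard the inconsistent combinations of equalities and parities in the case
   split. *)
have ab : (a == b) -> odd a = odd b /\ (a == c) = (b == c) by move/eqP->.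
have ac : (a == c) -> odd a = odd c /\ (a == b) = (b == c).
  by move/eqP->; rewrite (eq_sym c).
have bc : (b == c) -> odd b = odd c /\ (a == b) = (a == c) by move/eqP->.
move=> H; split=> o; apply/eqP; move: ab ac bc H o.
all: case: (a == b); case: (a == c); case: (b == c).
all: case: (odd a); case: (odd b); case: (odd c) => //=.
all: move=> h1 h2 h3.
all: by first [case: (h1 isT) | case: (h2 isT) | case: (h3 isT)].
Qed.

Lemma invr_nat_le (m n : nat) : (0 < m <= n)%N -> n%:R^-1 <= m%:R^-1 :> rat.
Proof.
by move=> /andP[m0 mn]; rewrite lef_pV2 ?posrE ?ltr0n ?ler_nat //; lia.
Qed.

(** The threshold 12 is sharp: [1/12 + 1/12 + 1/3] and [1/12 + 1/4 + 1/6] both equal [1/2]. The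
    first excludes odd [b] or [c], the second excludes even values from 6 on. *)
Lemma large_letter3 (a b c : nat) :
  (12 <= a)%N -> (3 <= b)%N -> (3 <= c)%N ->
  (odd b -> a = c) -> (odd c -> a = b) ->
  1 < 2 * (a%:R^-1 + b%:R^-1 + c%:R^-1) :> rat -> b = 4%N /\ c = 4%N.
Proof.
move=> a12 b3 c3 ob oc H.
have ha : a%:R^-1 <= 12%:R^-1 :> rat by apply: invr_nat_le; lia.
have hb k : (0 < k <= b)%N -> b%:R^-1 <= k%:R^-1 :> rat by apply: invr_nat_le.
have hc k : (0 < k <= c)%N -> c%:R^-1 <= k%:R^-1 :> rat by apply: invr_nat_le.
have bE : ~~ odd b.
  by apply/negP => /ob ca; have := hb 3%N b3; rewrite -ca in H; lra.
have cE : ~~ odd c.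
  by apply/negP => /oc ba; have := hc 3%N c3; rewrite -ba in H; lra.
have hb4 : b%:R^-1 <= 4%:R^-1 :> rat by apply: hb; lia.
have hc4 : c%:R^-1 <= 4%:R^-1 :> rat by apply: hc; lia.
have b6 : ~~ (6 <= b)%N by apply/negP => b6; have := hb 6%N b6; lra.
have c6 : ~~ (6 <= c)%N by apply/negP => c6; have := hc 6%N c6; lra.
by split; lia.
Qed.

(** Again 12 is the borderline, since [1/12 + 1/4 + 1/3 + 1/3 = 1]. *)
Lemma large_letter4 (a b c d : nat) :
  (12 <= a)%N -> (3 <= b)%N -> (3 <= c)%N -> (3 <= d)%N ->
  2 < 2 * (a%:R^-1 + b%:R^-1 + c%:R^-1 + d%:R^-1) :> rat ->
  [/\ b = 3%N, c = 3%N & d = 3%N].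
Proof.
move=> a12 b3 c3 d3 H.
have ha : a%:R^-1 <= 12%:R^-1 :> rat by apply: invr_nat_le; lia.
have hb k : (0 < k <= b)%N -> b%:R^-1 <= k%:R^-1 :> rat by apply: invr_nat_le.
have hc k : (0 < k <= c)%N -> c%:R^-1 <= k%:R^-1 :> rat by apply: invr_nat_le.
have hd k : (0 < k <= d)%N -> d%:R^-1 <= k%:R^-1 :> rat by apply: invr_nat_le.
have := hb 3%N b3; have := hc 3%N c3; have := hd 3%N d3 => hd3 hc3 hb3.
have b4 : ~~ (4 <= b)%N by apply/negP => b4; have := hb 4%N b4; lra.
have c4 : ~~ (4 <= c)%N by apply/negP => c4; have := hc 4%N c4; lra.
have d4 : ~~ (4 <= d)%N by apply/negP => d4; have := hd 4%N d4; lra.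
by split; lia.
Qed.

(** The borderline is [1/6 + 4/3 = 3/2]. *)
Lemma letter5_lt6 (a b c d e : nat) :
  (3 <= b)%N -> (3 <= c)%N -> (3 <= d)%N -> (3 <= e)%N ->
  3 < 2 * (a%:R^-1 + b%:R^-1 + c%:R^-1 + d%:R^-1 + e%:R^-1) :> rat ->
  (a < 6)%N.
Proof.
move=> b3 c3 d3 e3 H; rewrite ltnNge; apply/negP => a6.
have ha := @invr_nat_le 6 a a6; have hb := @invr_nat_le 3 b b3.
have hc := @invr_nat_le 3 c c3; have hd := @invr_nat_le 3 d d3.
by have he := @invr_nat_le 3 e e3; lra.
Qed.

(** * Assembling the classification *)

Lemma listed_44r (t : vertex_type) (r k : nat) :
  (5 <= r)%N -> [:: (4, 2); (r, 1)]%N = rot k t -> listed t.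
Proof. by move=> r5 E; right; left; exists r => //; exists k; left. Qed.

Lemma listed_333s (t : vertex_type) (s k : nat) :
  (4 <= s)%N -> [:: (3, 3); (s, 1)]%N = rot k t -> listed t.
Proof. by move=> s4 E; right; right; exists s => //; exists k; left. Qed.

Lemma classified_listed (w : seq nat) (m n d : nat) :
  all classified (words (iota m n) d) -> size w = d ->
  all (fun x => m <= x < m + n)%N w ->
  ~~ parity_obstructed w -> wf_vertex_type (run_lengths w) ->
  small_angle w -> listed (run_lengths w).
Proof.
move=> /allP cl sw wA.
have /mem_words : all (mem (iota m n)) w.
  by apply: sub_all wA => x; rewrite /= mem_iota.
rewrite sw => /cl.
rewrite /classified => + /negbTE wp wwf wa; rewrite wp wwf wa.
exact: listed_uptoP.
Qed.

Lemma word_listed (w : seq nat) :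
  (2 < size w)%N -> all (leq 3) w -> ~~ parity_obstructed w ->
  wf_vertex_type (run_lengths w) ->
  (size w)%:R - 2 * \sum_(x <- w) x%:R^-1 < 2 :> rat ->
  listed (run_lengths w).
Proof.
move=> w2 w3 wp wwf wS; have wa := small_angleP w3 wS.
(* Each inverse is at most [1/3], so a word of length [d] satisfies [d - 2d/3 < 2]. *)
have w6 : (size w < 6)%N.
  rewrite -(ltr_nat rat).
  suff : \sum_(x <- w) x%:R^-1 <= (size w)%:R * 3%:R^-1 :> rat by lra.
  rewrite mulr_natl -(count_predT w) -iter_addr_0 -big_const_seq.
  rewrite big_seq [leRHS]big_seq.
  by apply: ler_sum => x /(allP w3) x3; apply: invr_nat_le.
case: w w2 w6 w3 wp wwf wS wa => [//|a [//|b [//|c w]]] _.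
have E12 x : (11 < x)%N -> [/\ (x == 3)%N = false, (x == 4)%N = false,
    (3 == x)%N = false & (4 == x)%N = false].
  by move=> x12; split; apply/negbTE; lia.
case: w => [|d [|e [|//]]] _ w3 wp wwf wS wa.
- have [pa pb pc] := parity3 wp; move: wS; rewrite !big_cons big_nil /= => wS.
  have /and4P[a3 b3 c3 _] := w3.
  have [a12|a11] := ltnP 11 a.
    have [] := @large_letter3 a b c => //; first lra.
    (* The runs of [a, 4, 4] are [a] and then [4, 4]; rotating by one puts the fours first. *)
    move=> -> ->; apply: (@listed_44r _ a 1); first lia.
    by rewrite /=; have [_ -> _ _] := E12 _ a12.
  have [b12|b11] := ltnP 11 b.
    have [] := @large_letter3 b a c => //; [by move/pc | lra |].
    (* In [4, b, 4] the run of fours wraps around the ends, so the run lengths violate the cyclic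
       condition. *)
    move=> aE cE; move: wwf; rewrite aE cE /=; have [_ -> _ ->] := E12 _ b12.
    by rewrite /wf_vertex_type /= !andbF.
  have [c12|c11] := ltnP 11 c.
    have [] := @large_letter3 c a b => //; [by move/pa | by move/pb | lra |].
    move=> -> ->; apply: (@listed_44r _ c 0); first lia.
    by rewrite /=; have [_ _ _ ->] := E12 _ c12.
  apply: (@classified_listed [:: a; b; c] _ _ _ classified3) => //=; lia.
- move: wS; rewrite !big_cons big_nil /= => wS.
  have /and5P[a3 b3 c3 d3 _] := w3.
  have [a12|a11] := ltnP 11 a.
    have [] := @large_letter4 a b c d; rewrite //; first lra.
    move=> -> -> ->; apply: (@listed_333s _ a 1); first lia.
    by rewrite /=; have [-> _ _ _] := E12 _ a12.
  have [b12|b11] := ltnP 11 b.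
    have [] := @large_letter4 b a c d; rewrite //; first lra.
    (* The run of threes wraps around the ends here, and again when the large letter is third. *)
    move=> aE cE dE; move: wwf; rewrite aE cE dE /=.
    have [-> _ -> _] := E12 _ b12.
    by rewrite /wf_vertex_type /= !andbF.
  have [c12|c11] := ltnP 11 c.
    have [] := @large_letter4 c a b d; rewrite //; first lra.
    move=> aE bE dE; move: wwf; rewrite aE bE dE /=.
    have [-> _ -> _] := E12 _ c12.
    by rewrite /wf_vertex_type /= !andbF.
  have [d12|d11] := ltnP 11 d.
    have [] := @large_letter4 d a b c; rewrite //; first lra.
    move=> -> -> ->; apply: (@listed_333s _ d 0); first lia.
    by rewrite /=; have [_ _ -> _] := E12 _ d12.
  apply: (@classified_listed [:: a; b; c; d] _ _ _ classified4) => //=; lia.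
- move: wS; rewrite !big_cons big_nil /= => wS.
  have /and5P[a3 b3 c3 d3 /andP[e3 _]] := w3.
  have a6 : (a < 6)%N by apply: (@letter5_lt6 a b c d e) => //; lra.
  have b6 : (b < 6)%N by apply: (@letter5_lt6 b a c d e) => //; lra.
  have c6 : (c < 6)%N by apply: (@letter5_lt6 c a b d e) => //; lra.
  have d6 : (d < 6)%N by apply: (@letter5_lt6 d a b c e) => //; lra.
  have e6 : (e < 6)%N by apply: (@letter5_lt6 e a b c d) => //; lra.
  apply: (@classified_listed [:: a; b; c; d; e] _ _ _ classified5) => //=; lia.
Qed.

Theorem theorem3p1 (R : realType) (M : topologicalType) (X : cell_data M)
    (t : vertex_type) :
  two_manifold R M ->
  semi_equivelar R X t ->
  \sum_(b <- t) (b.2%:R * (b.1%:R - 2%:R) / b.1%:R : rat) < 2%:R ->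
  (exists2 t' : vertex_type, t' \in sporadic_types & same_type t t') \/
  (exists2 r : nat, (5 <= r)%N & same_type t [:: (4, 2); (r, 1)]%N) \/
  (exists2 s : nat, (4 <= s)%N & same_type t [:: (3, 3); (s, 1)]%N).
Proof.
move=> [M0 _ _ _] tP; have [w2 w3] := semi_equivelar_word M0 tP.
have wp := semi_equivelar_parity M0 tP; have [_ twf _] := tP.
rewrite angle_sum_expand // => tS.
(* The type is recovered from its word, to which [word_listed] applies. *)
rewrite -/(listed t) -(wf_expandK twf).
by apply: word_listed => //; rewrite wf_expandK.
Qed.
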